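(* Let $h\in(0,1]$ and let $u:h\mathbb{Z}^2\to\mathbb{R}$ be such that $$\mathcal{D}_2^+u_i\neq0\quad\text{and}\quad\mathcal{D}_2^-u_i\neq0\qquad\text{for all } i\in h\mathbb{Z}^2,$$ and assume that $$\sum_{i\in h\mathbb{Z}^2}\sum_{j=1}^2\Big[(\rho_i^+)^2\Big(|\mathcal{D}_j^+\vartheta_i^+|^2+|\mathcal{D}_j^-\vartheta_i^+|^2\Big)+(\rho_i^-)^2\Big(|\mathcal{D}_j^+\vartheta_i^-|^2+|\mathcal{D}_j^-\vartheta_i^-|^2\Big)\Big]=0.$$ Then there exist $\widetilde u:h\mathbb{Z}\to\mathbb{R}$ and $c^+,c^-\in\mathbb{R}$ such that $$u_{(hk,hm)}=\sum_{j=0}^{|k|}\binom{|k|}{j}(c^{\sigma_k})^j(1-c^{\sigma_k})^{|k|-j}\,\widetilde u_{h(m+\sigma_kj)}\qquad\text{for every } k,m\in\mathbb{Z},$$ where $\sigma_k:=+$ if $k>0$, $\sigma_k:=-$ if $k<0$, $\sigma_k:=0$ if $k=0$, and $c^{\sigma_0}=c^0:=1$. In addition (with the same $c^+$ and $c^-$), for both choices of sign, $$\frac{u_{i\pm he_1}-u_i}{u_{i\pm he_2}-u_i}=c^\pm\qquad\text{for all } i\in h\mathbb{Z}^2 .$$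
   Context: Notation. $e_1=(1,0)$, $e_2=(0,1)$, $\mathcal{I}=\sqrt{-1}$. For $g:h\mathbb{Z}^2\to\mathbb{R}$, $i\in h\mathbb{Z}^2$, $j\in\{1,2\}$: $$\mathcal{D}_j^+g_i:=\frac{g_{i+he_j}-g_i}{h},\qquad\mathcal{D}_j^-g_i:=\frac{g_i-g_{i-he_j}}{h}.$$ For a sign $s\in\{+,-\}$ set $U_i^s:=\mathcal{D}_1^su_i+\mathcal{I}\,\mathcal{D}_2^su_i\in\mathbb{C}$ and $\rho_i^s:=|U_i^s|$ (which is positive under the assumptions of the claim), and let $\vartheta_i^s\in(-\pi,\pi]$ be the unique angle such that $U_i^s=\rho_i^se^{\mathcal{I}\vartheta_i^s}$. In the expression $m+\sigma_kj$ the symbol $\sigma_k$ is read as the number $+1$, $-1$ or $0$; in $c^{\sigma_k}$ it is a superscript label selecting $c^+$, $c^-$ or $c^0=1$ (not an exponent). The convention $0^0=1$ is used for powers. *)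

(* Defs.v *)
From HB Require Import structures.
From mathcomp Require Import all_boot all_order all_algebra.
From mathcomp Require Import all_classical all_reals all_analysis.
From mathcomp Require Import complex.
From mathcomp Require Import ring lra.

Set Implicit Arguments.
Unset Strict Implicit.
Unset Printing Implicit Defensive.

Import Order.TTheory GRing.Theory Num.Theory.
Import numFieldNormedType.Exports.

Local Open Scope classical_set_scope.
Local Open Scope complex_scope.
Local Open Scope ring_scope.

(* A real function on h Z (resp. h Z^2) is represented by a function on R
   (resp. R * R), of which only the values on the lattice are ever used. *)
Definition hZ (R : realType) (h : R) : set R :=
  [set h * k%:~R | k in [set: int]].

Definition hZ2 (R : realType) (h : R) : set (R * R) := hZ h `*` hZ h.

Definition e1 (R : realType) : R * R := (1, 0).
Definition e2 (R : realType) : R * R := (0, 1).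

Definition Dp (R : realType) (h : R) (e : R * R) (g : R * R -> R)
  (i : R * R) : R := (g (i + h *: e) - g i) / h.

Definition Dm (R : realType) (h : R) (e : R * R) (g : R * R -> R)
  (i : R * R) : R := (g i - g (i - h *: e)) / h.

Definition Up (R : realType) (h : R) (u : R * R -> R) (i : R * R) : R[i] :=
  Dp h (e1 R) u i +i* Dp h (e2 R) u i.

Definition Um (R : realType) (h : R) (u : R * R -> R) (i : R * R) : R[i] :=
  Dm h (e1 R) u i +i* Dm h (e2 R) u i.

Definition modulus (R : realType) (z : R[i]) : R := ComplexField.Normc.normc z.

(* e^{I t}, by Euler's formula *)
Definition expi (R : realType) (t : R) : R[i] := cos t +i* sin t.

Definition is_arg (R : realType) (z : R[i]) (t : R) : Prop :=
  - pi < t <= pi /\ z = (modulus z)%:C * expi t.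

(* The chosen angle is the only one as soon as z <> 0 (lemmas below); for
   z = 0 it carries no information. *)
Definition arg (R : realType) (z : R[i]) : R := xget 0 [set t | is_arg z t].

Lemma is_arg_exists (R : realType) (z : R[i]) : z != 0 -> exists t, is_arg z t.
Proof.
case: z => a b z0.
have E : 0 <= a ^+ 2 + b ^+ 2 by rewrite addr_ge0 ?sqr_ge0.
have r0 : 0 < Num.sqrt (a ^+ 2 + b ^+ 2).
  rewrite sqrtr_gt0 lt_neqAle E andbT eq_sym.
  apply: contra z0; rewrite paddr_eq0 ?sqr_ge0// !sqrf_eq0.
  by move=> /andP[/eqP-> /eqP->].
rewrite /is_arg /modulus /=; set r := Num.sqrt _ in r0 *.
have rr : r ^+ 2 = a ^+ 2 + b ^+ 2 by rewrite sqr_sqrtr.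
have rn0 : r != 0 by rewrite gt_eqF.
have Hx : -1 <= a / r <= 1.
  by rewrite ler_pdivlMr// ler_pdivrMr//; apply/andP; split; nra.
have Hs : Num.sqrt (1 - (a / r) ^+ 2) = `|b| / r.
  have -> : 1 - (a / r) ^+ 2 = (`|b| / r) ^+ 2.
    rewrite !expr_div_n real_normK ?num_real//.
    have -> : b ^+ 2 = r ^+ 2 - a ^+ 2 by rewrite rr; ring.
    by field.
  by rewrite sqrtr_sqr ger0_norm// divr_ge0// ltW.
have c : cos (acos (a / r)) = a / r by rewrite acosK// in_itv.
have key t : cos t = a / r -> sin t = b / r ->
    a +i* b = r%:C * expi t.
  by move=> ct st; rewrite /expi ct st; simpc; congr (_ +i* _); field.
have pi0 := @pi_gt0 R; have A0 := acos_ge0 Hx; have Api := acos_lepi Hx.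
have [b0|b0] := leP 0 b.
  exists (acos (a / r)); split; first by lra.
  by apply: key => //; rewrite sin_acos// Hs ger0_norm.
exists (- acos (a / r)); split; last first.
  by apply: key; rewrite ?cosN// sinN sin_acos// Hs ltr0_norm// mulNr opprK.
suff : acos (a / r) < pi by lra.
apply: acos_ltpi; rewrite ltr_pdivlMr// ler_pdivrMr//.
by apply/andP; split; nra.
Qed.

Lemma is_arg_unique (R : realType) (z : R[i]) (s t : R) :
  z != 0 -> is_arg z s -> is_arg z t -> s = t.
Proof.
move=> z0 [Hs es] [Ht et].
have m0 : (modulus z)%:C != 0.
  by apply: contra z0 => /eqP m0; rewrite es m0 mul0r.
have [cst sst] : cos s = cos t /\ sin s = sin t.
  by move: es; rewrite [LHS]et => /(mulfI m0)[-> ->].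
have pi0 := @pi_gt0 R.
have sgn (x : R) : - pi < x <= pi -> 0 <= sin x -> 0 <= x.
  move=> Hx sx; rewrite leNgt; apply/negP => x0.
  have : 0 < sin (- x) by apply: sin_gt0_pi; lra.
  by rewrite sinN; lra.
have [sx|sx] := leP 0 (sin s).
  have s0 := sgn _ Hs sx; have t0 : 0 <= t by apply: sgn; rewrite // -sst.
  rewrite -[s]cosK ?in_itv/=; last by lra.
  by rewrite cst cosK// in_itv/=; lra.
have neg (x : R) : - pi < x <= pi -> sin x < 0 -> x <= 0.
  move=> Hx sx'; rewrite leNgt; apply/negP => x0.
  have : 0 <= sin x by apply: sin_ge0_pi; lra.
  by lra.
have s0 := neg _ Hs sx; have t0 : t <= 0 by apply: neg; rewrite // -sst.
apply: oppr_inj; rewrite -(@cosKN R s) ?cst ?cosKN//; lra.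
Qed.

Lemma argP (R : realType) (z : R[i]) : z != 0 -> is_arg z (arg z).
Proof. by move=> /is_arg_exists; exact: xgetPex. Qed.

Definition rhop (R : realType) (h : R) (u : R * R -> R) (i : R * R) : R :=
  modulus (Up h u i).
Definition rhom (R : realType) (h : R) (u : R * R -> R) (i : R * R) : R :=
  modulus (Um h u i).
Definition thetap (R : realType) (h : R) (u : R * R -> R) (i : R * R) : R :=
  arg (Up h u i).
Definition thetam (R : realType) (h : R) (u : R * R -> R) (i : R * R) : R :=
  arg (Um h u i).

(* c^{sigma_k}; the number sigma_k itself is sgz k *)
Definition csigma (R : realType) (cp cm : R) (k : int) : R :=
  if (0 < k)%R then cp else if (k < 0)%R then cm else 1.

(* Main.v *)
Require Import Defs.
From HB Require Import structures.
From mathcomp Require Import all_boot all_order all_algebra.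
From mathcomp Require Import all_classical all_reals all_analysis.
From mathcomp Require Import complex ring lra.
Import Order.TTheory GRing.Theory Num.Theory.
Import numFieldNormedType.Exports.
Local Open Scope classical_set_scope.
Local Open Scope ring_scope.

(** A vanishing sum of nonnegative terms has vanishing terms, and the moduli
    are positive because the second components of the discrete gradients do not
    vanish.  Hence both angles have zero differences in the two coordinate
    directions and are constant on the lattice ([lattice_constant]).  A complex
    number with nonzero imaginary part has the slope [cos t / sin t], where [t]
    is its argument ([slope_arg]); so the forward gradients all have the same
    slope [cp] and the backward ones the same slope [cm], which is the assertion
    on the quotients.

    Clearing denominators, that assertion reads
      [u (i + s e1) = (1 - c) u i + c u (i + s e2)],  [s = 1, -1]:
    one step in the first direction acts on columns as the operator
    [(1 - c) id + c S], where [S] is the shift by [s] in the second direction.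
    Its [n]-th power is given by the binomial formula ([binomial_recurrence]),
    and the theorem follows with [ut] the restriction of [u] to the zeroth
    column. *)

Lemma esum_eq0_term (R : realType) (T : choiceType) (D : set T)
    (a : T -> R) : \esum_(i in D) (a i)%:E = 0%E ->
  (forall i, 0 <= a i) -> forall i, D i -> a i = 0.
Proof.
move=> s0 a0 i Di; apply/eqP.
rewrite eq_le a0 andbT -lee_fin -[leRHS]/0%E -s0.
apply: esum_ge; exists [set i]; last by rewrite fsbig_set1.
by split; [exact: finite_set1 | move=> _ ->].
Qed.

(** This is the binomial expansion of [((1 - c) id + c S) ^ n], [S] being the
    shift by [s]; the induction is Pascal's rule. *)
Lemma binomial_recurrence (R : comPzRingType) (c : R) (s : int)
    (f : nat -> int -> R) :
  (forall n m, f n.+1 m = (1 - c) * f n m + c * f n (m + s)) ->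
  forall n m, f n m =
    \sum_(0 <= j < n.+1)
      'C(n, j)%:R * c ^+ j * (1 - c) ^+ (n - j) * f 0%N (m + s * j%:Z).
Proof.
move=> step; elim=> [|n IH] m.
  by rewrite big_nat1 bin0 subnn !expr0 !mul1r mulr0 addr0.
rewrite step !IH !big_distrr /= [RHS]big_nat_recl//.
under [X in _ = _ + X]eq_bigr => j _.
  rewrite binS natrD subSS !mulrDl.
  over.
rewrite big_split /= addrA; congr (_ + _); last first.
  apply: eq_bigr => j _.
  have -> : m + s * j.+1%:Z = m + s + s * j%:Z by rewrite intS; ring.
  by rewrite exprS; ring.
(* The top term carries ['C(n, n.+1) = 0], so the range can be shortened. *)
rewrite [in RHS]big_nat_recr//= (bin_small (ltnSn n)) !mul0r addr0.
rewrite big_nat_recl// !bin0 !subn0 exprS; congr (_ + _); first by ring.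
apply: eq_big_nat => j /andP[_ jn].
by rewrite -(subnSK jn) [(1 - c) ^+ (_).+1]exprS; ring.
Qed.

Lemma int_shift_constant (T : Type) (f : int -> T) :
  (forall k, f (k + 1) = f k) -> forall k, f k = f 0.
Proof.
move=> step; elim/int_rect => // n IH.
  by rewrite -addn1 PoszD step.
by rewrite -IH -[LHS]step intS addrC opprD addrA subrr add0r.
Qed.

Section Lattice.
Variables (R : realType) (h : R).
Implicit Types (u g : R * R -> R).

Definition lattice_pt (k m : int) : R * R := (h * k%:~R, h * m%:~R).

Lemma hZ2_lattice_pt k m : hZ2 h (lattice_pt k m).
Proof. by split; [exists k | exists m]. Qed.

Lemma hZ2P i : hZ2 h i -> exists k m, i = lattice_pt k m.
Proof. by case: i => x y [[k _ /= <-] [m _ /= <-]]; exists k, m. Qed.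

Lemma lattice_ptD1 k m s :
  lattice_pt k m + (h * s%:~R) *: e1 R = lattice_pt (k + s) m.
Proof.
rewrite /lattice_pt /e1; congr (_, _) => /=.
  by rewrite rmorphD /= mulrDr /GRing.scale /= mulr1.
by rewrite scaler0 addr0.
Qed.

Lemma lattice_ptD2 k m s :
  lattice_pt k m + (h * s%:~R) *: e2 R = lattice_pt k (m + s).
Proof.
rewrite /lattice_pt /e2; congr (_, _) => /=.
  by rewrite scaler0 addr0.
by rewrite rmorphD /= mulrDr /GRing.scale /= mulr1.
Qed.

Hypothesis h_gt0 : 0 < h.

Lemma lattice_constant g :
  (forall i, hZ2 h i -> Dp h (e1 R) g i = 0) ->
  (forall i, hZ2 h i -> Dp h (e2 R) g i = 0) ->
  forall i, hZ2 h i -> g i = g (lattice_pt 0 0).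
Proof.
have shift e i : Dp h e g i = 0 -> g (i + h *: e) = g i.
  by move=> /eqP; rewrite mulf_eq0 invr_eq0 (gt_eqF h_gt0) orbF subr_eq0 => /eqP.
move=> d1 d2 _ /hZ2P[k [m ->]].
rewrite (int_shift_constant _ (fun k => g (lattice_pt k m))) => [|k'].
  apply: (int_shift_constant _ (fun m => g (lattice_pt 0 m))) => m'.
  rewrite -lattice_ptD2 mulr1; apply: shift; apply: d2; exact: hZ2_lattice_pt.
rewrite -lattice_ptD1 mulr1; apply: shift; apply: d1; exact: hZ2_lattice_pt.
Qed.

End Lattice.

Lemma modulus_gt0 (R : realType) (z : R[i]) : complex.Im z != 0 -> 0 < modulus z.
Proof.
case: z => a b /= b0; rewrite /modulus /= sqrtr_gt0.
by rewrite ltr_wpDl ?sqr_ge0// lt_neqAle sqr_ge0 eq_sym sqrf_eq0 b0.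
Qed.

Lemma slope_arg (R : realType) (z : R[i]) : complex.Im z != 0 ->
  complex.Re z / complex.Im z = cos (arg z) / sin (arg z).
Proof.
move=> b0; have m0 := modulus_gt0 _ z b0.
have z0 : z != 0 by apply: contra b0 => /eqP->.
have [_ ez] := argP z0.
rewrite [in LHS]ez; move: (modulus z) (arg z) m0 => r t r0.
by rewrite /expi /= !mul0r subr0 addr0 -mulf_div divff ?gt_eqF// mul1r.
Qed.

(** The weights [rhop] and [rhom] are positive, because the imaginary parts of
    [Up] and [Um] are the second differences assumed nonzero; so each squared
    difference of the angles must vanish by itself. *)
Lemma zero_energy_angles (R : realType) (h : R) (u : R * R -> R) :
  (forall i, hZ2 h i -> Dp h (e2 R) u i != 0 /\ Dm h (e2 R) u i != 0) ->
  \esum_(i in hZ2 h)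
    (\sum_(e <- [:: e1 R; e2 R])
       ((rhop h u i) ^+ 2 * (`|Dp h e (thetap h u) i| ^+ 2
                             + `|Dm h e (thetap h u) i| ^+ 2)
        + (rhom h u i) ^+ 2 * (`|Dp h e (thetam h u) i| ^+ 2
                               + `|Dm h e (thetam h u) i| ^+ 2)))%:E = 0%E ->
  forall i e, hZ2 h i -> e \in [:: e1 R; e2 R] ->
    Dp h e (thetap h u) i = 0 /\ Dp h e (thetam h u) i = 0.
Proof.
move=> D2n0 E0 i e Hi He.
have [/(modulus_gt0 _ (Up h u i)) rp0 /(modulus_gt0 _ (Um h u i)) rm0] :=
  D2n0 i Hi.
have weighted_ge0 (r a b : R) : 0 <= r ^+ 2 * (`|a| ^+ 2 + `|b| ^+ 2).
  by rewrite mulr_ge0 ?addr_ge0 ?sqr_ge0.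
have weighted_eq0 (r a b : R) : 0 < r ->
    r ^+ 2 * (`|a| ^+ 2 + `|b| ^+ 2) = 0 -> a = 0.
  move=> r0 /eqP; rewrite mulf_eq0 sqrf_eq0 gt_eqF//=.
  rewrite paddr_eq0 ?sqr_ge0// => /andP[].
  by rewrite sqrf_eq0 normr_eq0 => /eqP.
have /eqP := esum_eq0_term _ _ _ _ E0 (fun j => sumr_ge0 _ (fun e _ =>
  addr_ge0 (weighted_ge0 _ _ _) (weighted_ge0 _ _ _))) i Hi.
rewrite psumr_eq0 => [|? _]; last by rewrite addr_ge0.
move=> /allP/(_ _ He); rewrite /= paddr_eq0// => /andP[/eqP p0 /eqP m0].
by split; [apply: weighted_eq0 rp0 p0 | apply: weighted_eq0 rm0 m0].
Qed.

Theorem lemma1p3 (R : realType) (h : R) (u : R * R -> R) :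
  0 < h <= 1 ->
  (forall i, hZ2 h i -> Dp h (e2 R) u i != 0 /\ Dm h (e2 R) u i != 0) ->
  \esum_(i in hZ2 h)
    (\sum_(e <- [:: e1 R; e2 R])
       ((rhop h u i) ^+ 2 * (`|Dp h e (thetap h u) i| ^+ 2
                             + `|Dm h e (thetap h u) i| ^+ 2)
        + (rhom h u i) ^+ 2 * (`|Dp h e (thetam h u) i| ^+ 2
                               + `|Dm h e (thetam h u) i| ^+ 2)))%:E = 0%E ->
  exists (ut : R -> R) (cp cm : R),
    (forall k m : int,
       u (h * k%:~R, h * m%:~R) =
       \sum_(0 <= j < `|k|%N.+1)
          'C(`|k|%N, j)%:R * csigma cp cm k ^+ j
          * (1 - csigma cp cm k) ^+ (`|k|%N - j)
          * ut (h * (m + sgz k * j%:Z)%:~R)) /\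
    (forall i, hZ2 h i ->
       (u (i + h *: e1 R) - u i) / (u (i + h *: e2 R) - u i) = cp) /\
    (forall i, hZ2 h i ->
       (u (i - h *: e1 R) - u i) / (u (i - h *: e2 R) - u i) = cm).
Proof.
move=> /andP[h0 _] D2n0 E0.
have dth := zero_energy_angles R h u D2n0 E0.
have [e1in e2in] : e1 R \in [:: e1 R; e2 R] /\ e2 R \in [:: e1 R; e2 R].
  by rewrite !inE !eqxx orbT.
set tp := thetap h u (lattice_pt R h 0 0).
set tm := thetam h u (lattice_pt R h 0 0).
have tpE i : hZ2 h i -> thetap h u i = tp.
  apply: lattice_constant => // j Hj; first by have [] := dth j _ Hj e1in.
  by have [] := dth j _ Hj e2in.
have tmE i : hZ2 h i -> thetam h u i = tm.
  apply: lattice_constant => // j Hj; first by have [] := dth j _ Hj e1in.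
  by have [] := dth j _ Hj e2in.
pose cp := cos tp / sin tp; pose cm := cos tm / sin tm.
have hn0 : h != 0 by rewrite gt_eqF.
have cpE i : hZ2 h i ->
    (u (i + h *: e1 R) - u i) / (u (i + h *: e2 R) - u i) = cp.
  move=> Hi; rewrite /cp -(tpE i Hi) -slope_arg; last by case: (D2n0 i Hi).
  by rewrite /= /Dp -mulf_div divff ?invr_eq0// mulr1.
have cmE i : hZ2 h i ->
    (u (i - h *: e1 R) - u i) / (u (i - h *: e2 R) - u i) = cm.
  move=> Hi; rewrite /cm -(tmE i Hi) -slope_arg; last by case: (D2n0 i Hi).
  rewrite /= /Dm -mulf_div divff ?invr_eq0// mulr1.
  by rewrite -[X in X / _]opprB -[X in _ / X]opprB invrN mulrNN.
exists (fun x => u (0, x)), cp, cm; split=> // k m.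
set c := csigma cp cm k; set s := sgz k.
(* For [k = 0] there is no step ([s = 0]), and the convention [c = 1] makes the
   relation trivially true. *)
have step l n : u (lattice_pt R h (l + s) n) =
    (1 - c) * u (lattice_pt R h l n) + c * u (lattice_pt R h l (n + s)).
  have Hi := hZ2_lattice_pt R h l n; set i := lattice_pt R h l n in Hi *.
  have [Dp0 Dm0] := D2n0 _ Hi.
  rewrite -lattice_ptD1 -lattice_ptD2 -/i /c /s /csigma.
  have [_|_|_] := sgzP k.
  - by rewrite mulr0 !scale0r !addr0 subrr; ring.
  - rewrite mulr1 -(cpE _ Hi).
    have d0 : u (i + h *: e2 R) - u i != 0.
      by apply: contra Dp0 => /eqP d0; rewrite /Dp d0 mul0r.
    by field.
  - rewrite mulrN1 !scaleNr -(cmE _ Hi).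
    have d0 : u (i - h *: e2 R) - u i != 0.
      by apply: contra Dm0; rewrite /Dm -opprB oppr_eq0 => /eqP->; rewrite mul0r.
    by field.
have := binomial_recurrence _ c s (fun n m => u (lattice_pt R h (s * n%:Z) m)).
move=> /(_ _ `|k|%N m) /=; rewrite mulr0 /lattice_pt mulr0 => <- => [|n l].
  by rewrite abszE -intEsg.
by rewrite -step intS mulrDr mulr1 addrC.
Qed.
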